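(* Suppose that a numerical semigroup $\Lambda$ has genus $g$ and ordinarization number $r\geq \frac{g+2}{3}$. Then $\Lambda$ has $2r$ intervals of gaps if $g$ is even and $2r+1$ intervals of gaps if $g$ is odd.
   Context: $\mathbb{N}_0$ is the set of non-negative integers. A numerical semigroup is a subset of $\mathbb{N}_0$ that is closed under addition, contains $0$, and has finite complement in $\mathbb{N}_0$. The elements of the complement are called gaps, the number of gaps is the genus, the largest gap is the Frobenius number, and the smallest non-zero element of the semigroup is its multiplicity. An interval of gaps is a maximal set of consecutive integers all of which are gaps. A numerical semigroup of genus $g$ is ordinary if its gaps are all in a row, i.e. it equals $\{0,g+1,g+2,\dots\}$; $\mathbb{N}_0$ (genus $0$) counts as ordinary. The ordinarization transform $\Lambda'$ of a non-ordinary numerical semigroup $\Lambda$ with Frobenius number $F$ and multiplicity $m$ is $(\Lambda\setminus\{m\})\cup\{F\}$, which is a numerical semigroup of the same genus; the ordinarization transform of an ordinary semigroup is itself. Put $\Lambda^{(0)}=\Lambda$ and $\Lambda^{(i)}=(\Lambda^{(i-1)})'$. The ordinarization number of $\Lambda$ is the smallest $i\geq 0$ such that $\Lambda^{(i)}$ is ordinary (such $i$ exists). *)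

(* Defs.v *)
From mathcomp Require Import all_boot finmap.
From mathcomp Require Import boolp classical_sets functions cardinality.

Set Implicit Arguments.
Unset Strict Implicit.
Unset Printing Implicit Defensive.

Local Open Scope classical_set_scope.
Local Open Scope nat_scope.

Definition numerical_semigroup (S : set nat) : Prop :=
  [/\ S 0, forall a b, S a -> S b -> S (a + b) & finite_set (~` S)].

Definition gaps (S : set nat) : set nat := ~` S.

Definition genus (S : set nat) : nat := #|` fset_set (gaps S)|.

(* The value is 0 when there are no gaps. *)
Definition frobenius (S : set nat) : nat :=
  \max_(x <- fset_set (gaps S)) x.

(* The least element of A; the value 0 is only a default for A = set0. *)
Definition least (A : set nat) : nat :=
  xget 0 [set m | A m /\ forall n, A n -> m <= n].

Lemma leastP (A : set nat) :
  A !=set0 -> A (least A) /\ forall n, A n -> least A <= n.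
Proof.
move=> [a Aa].
have exA : exists n, `[< A n >] by exists a; apply/asboolP.
have [m /asboolP Am minm] := ex_minnP exA.
apply: (@xgetPex _ 0 [set m | A m /\ forall n, A n -> m <= n]).
by exists m; split=> // n An; apply: minm; apply/asboolP.
Qed.

Definition multiplicity (S : set nat) : nat := least (S `\ 0).

Definition ordinary (S : set nat) : Prop :=
  S = [set n | n = 0 \/ genus S < n].

Definition ordinarization (S : set nat) : set nat :=
  if `[< ordinary S >] then S
  else (S `\ multiplicity S) `|` [set frobenius S].

Definition ordinarization_number (S : set nat) : nat :=
  least [set i | ordinary (iter i ordinarization S)].

Definition consecutive (I : set nat) : Prop :=
  exists a b, a <= b /\ I = [set n | a <= n <= b].

Definition gap_interval (S I : set nat) : Prop :=
  [/\ consecutive I, I `<=` gaps S &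
      forall J, consecutive J -> J `<=` gaps S -> I `<=` J -> J = I].

(* When S has finite complement, there are finitely many intervals of gaps,
   so this is their actual number. *)
Definition num_gap_intervals (S : set nat) : nat :=
  #|` fset_set [set I | gap_interval S I]|.

(* Main.v *)
Require Import Defs.
From mathcomp Require Import all_boot all_order all_algebra.
From mathcomp Require Import classical_sets.
From mathcomp Require Import boolp functions cardinality.
From mathcomp Require Import finmap zify.

(** Why the theorem is true.  In a non-ordinary semigroup, replacing the
    multiplicity by the Frobenius number removes one element of [1, g] and adds
    none; a semigroup is ordinary exactly when no element is left there.  So r
    is the number of elements of S in [1, g] ([ordinarization_numberE]).  List
    the elements of S in [0, g] as 0 = a_0 < a_1 < ... < a_r, and call this
    set A.

    All gaps are smaller than 2g ([gap_lt_double_genus]), so S has exactly g + 1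
    elements in [0, 2g], and A + A is among them.  Thus
    |A + A| <= g + 1 < 3r, a very small sumset for a set of r + 1 elements.
    A theorem in the style of Freiman's 3k - 3 theorem ([sumset_freiman]) says
    that a set with such a small sumset has all its elements divisible by some
    d >= 2, provided that a_i >= 2i for all i.  The proviso holds in S: if more
    than half of an initial segment belongs to S, every later integer is a sum
    of two elements of S, so S would have too few gaps ([enum_below_sparse]).
    Finally d r <= a_r <= g < 3r forces d = 2: every element of S up to g is
    even ([small_elements_even]).

    Now the even elements, halved, form a semigroup that contains more than half
    of [0, g/2], hence all even numbers from g - 1 on are in S.  An interval of
    gaps is determined by its right end, a gap x with x + 1 in S.  Such an x is
    odd, since an even gap lies below g - 1 and is followed by an odd number at
    most g, which is a gap.  Conversely an odd gap x fails to be a right end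
    exactly when x + 1 is an even gap, and every even gap arises in this way.
    So there are as many intervals as odd gaps minus even gaps
    ([card_right_ends]).  There are floor(g/2) - r even gaps, and the difference
    is g - 2 (floor(g/2) - r), as claimed. *)

Set Implicit Arguments.
Unset Strict Implicit.
Unset Printing Implicit Defensive.

Local Open Scope classical_set_scope.
Local Open Scope nat_scope.

(** * Sumsets of increasing sequences *)

(** X and its reflection x |-> s - x both lie in [0, s], and are too large to be
    disjoint. *)
Lemma pigeonhole_sum (X : seq nat) (s : nat) :
  uniq X -> {in X, forall x, x <= s} -> s.+1 < 2 * size X ->
  exists x y, [/\ x \in X, y \in X & x + y = s].
Proof.
move=> uX leX ltX.
case: (boolP (has (mem X) [seq s - x | x <- X])) => [/hasP[_ /mapP[x xX ->] yX]|].
  by exists x, (s - x); split=> //; rewrite subnKC ?leX.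
rewrite has_sym => disj.
suff : size (X ++ [seq s - x | x <- X]) <= size (iota 0 s.+1).
  by rewrite size_cat size_map size_iota; lia.
apply: uniq_leq_size.
  rewrite cat_uniq uX map_inj_in_uniq ?uX ?andbT //=; first by rewrite has_sym.
  by move=> x y /leX ? /leX ? ; lia.
move=> x; rewrite mem_cat mem_iota => /orP[/leX|/mapP[y _ ->]]; lia.
Qed.

Definition sumset (a : nat -> nat) (m n : nat) : seq nat :=
  undup [seq a i + a j | i <- index_iota m n.+1, j <- index_iota m n.+1].

Lemma sumsetP (a : nat -> nat) (m n z : nat) :
  reflect (exists i j, [/\ m <= i <= n, m <= j <= n & z = a i + a j])
          (z \in sumset a m n).
Proof.
rewrite mem_undup; apply: (iffP allpairsP) => [[[i j] /= []]|[i [j [Hi Hj ->]]]].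
  by rewrite !mem_index_iota !ltnS => Hi Hj ->; exists i, j.
by exists (i, j); rewrite !mem_index_iota !ltnS.
Qed.

Lemma sumset_uniq (a : nat -> nat) (m n : nat) : uniq (sumset a m n).
Proof. exact: undup_uniq. Qed.

(** The sums a_0 + a_0 < ... < a_0 + a_n < a_1 + a_n < ... < a_n + a_n. *)
Lemma sumset_ge2n (a : nat -> nat) (n : nat) :
  {homo a : i j / i < j} -> 2 * n + 1 <= size (sumset a 0 n).
Proof.
move=> a_incr; have a_mono := leq_mono a_incr; have a_lt := leqW_mono a_mono.
pose chain := [seq a 0 + a j | j <- iota 0 n.+1] ++ [seq a j + a n | j <- iota 1 n].
have -> : 2 * n + 1 = size chain by rewrite size_cat !size_map !size_iota; lia.
have aI : injective a by apply: incn_inj.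
apply: uniq_leq_size.
  rewrite cat_uniq !map_inj_uniq ?iota_uniq ?andTb ?andbT; last 2 first.
  - by move=> j k /eqP /=; rewrite ?(eqn_add2l, eqn_add2r) => /eqP/aI.
  - by move=> j k /eqP /=; rewrite ?(eqn_add2l, eqn_add2r) => /eqP/aI.
  apply/hasPn => z /mapP[j]; rewrite mem_iota => jn ->.
  apply/negP => /mapP[k]; rewrite mem_iota => kn E.
  have := a_lt 0 j; have := a_mono k n; lia.
move=> z; rewrite mem_cat => /orP[] /mapP[j]; rewrite mem_iota => jn ->.
  by apply/sumsetP; exists 0, j; split=> //; lia.
by apply/sumsetP; exists j, n; split=> //; lia.
Qed.

(** The hypotheses describe a set that is sparse on the whole, but each of whose
    proper final segments (those starting after a_i) fills more than half of
    its span.  By density every integer from 2 a_n - 2 (n - i) + 2 up to 2 a_n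
    is a sum, by a pigeonhole argument around the top; sparseness puts these
    2 (n - i) - 1 sums above the n - i + 1 sums a_i + a_j. *)
Lemma sumset_late_density (a : nat -> nat) (i n : nat) :
  {homo a : i j / i < j} -> i < n ->
  a i + 2 * n <= a n + 2 * i ->
  (forall j, i < j < n -> a n + 2 * j < a j + 2 * n) ->
  3 * (n - i) <= size (sumset a i n).
Proof.
move=> a_incr lt_in sparse dense.
have a_mono := leq_mono a_incr; have a_lt := leqW_mono a_mono.
have aI : injective a by apply: incn_inj.
pose L := [seq a i + a j | j <- index_iota i n.+1] ++
          [seq 2 * a n - s | s <- iota 0 (2 * (n - i)).-1].
have -> : 3 * (n - i) = size L.
  by rewrite size_cat !size_map !size_iota; lia.
apply: uniq_leq_size.
  rewrite cat_uniq; apply/and3P; split.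
  - by rewrite map_inj_uniq ?iota_uniq // => j k /eqP; rewrite eqn_add2l => /eqP/aI.
  - apply/hasPn => z /mapP[s]; rewrite mem_iota => sn ->.
    apply/negP => /mapP[k]; rewrite mem_index_iota => kn E.
    have := a_mono k n; lia.
  - by rewrite map_inj_in_uniq ?iota_uniq // => j k; rewrite !mem_iota; lia.
move=> z; rewrite mem_cat => /orP[] /mapP[s].
  by rewrite mem_index_iota => jn ->; apply/sumsetP; exists i, s; split=> //; lia.
rewrite mem_iota => sn ->.
(* Density bounds a_n - a_(n-q) by 2q - 1, so the distances to a_n that are at
   most s contain those with q <= (s + 1)/2, which is enough for the pigeonhole. *)
pose X := [seq a n - a (n - q) | q <- iota 0 (s.+1)./2.+1].
have le_an q : a (n - q) <= a n by rewrite a_mono; lia.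
have [|||_ [_ [/mapP[p pX ->] /mapP[q qX ->] E]]] := @pigeonhole_sum X s; last 1 first.
- apply/sumsetP; exists (n - p), (n - q); rewrite !mem_iota in pX qX.
  by have := le_an p; have := le_an q; split; lia.
- rewrite map_inj_in_uniq ?iota_uniq // => p q; rewrite !mem_iota => Hp Hq E.
  have /aI : a (n - p) = a (n - q) by have := le_an p; have := le_an q; lia.
  lia.
- move=> y /mapP[q]; rewrite mem_iota => Hq ->.
  case: (posnP q) => [->|q0]; first by rewrite subn0 subnn.
  have := dense (n - q); lia.
rewrite size_map size_iota; lia.
Qed.

(** Sums of the part up to a_i are at most 2 a_i and sums of the part from a_i on
    are at least 2 a_i, so the two sumsets share only 2 a_i; E collects mixed
    sums that neither part accounts for. *)
Lemma sumset_split (a : nat -> nat) (i n : nat) (E : seq nat) :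
  {homo a : i j / i < j} -> i <= n -> uniq E -> {subset E <= sumset a 0 n} ->
  (forall z, z \in E -> z \notin sumset a 0 i /\ z \notin sumset a i n) ->
  size (sumset a 0 i) + size (sumset a i n) + size E <= (size (sumset a 0 n)).+1.
Proof.
move=> a_incr le_in uE subE newE.
have a_mono := leq_mono a_incr.
have mid : a i + a i \in sumset a 0 i by apply/sumsetP; exists i, i; split=> //; lia.
pose L := E ++ rem (a i + a i) (sumset a 0 i) ++ sumset a i n.
suff : size L <= size (sumset a 0 n).
  rewrite !size_cat size_rem //.
  by case: (sumset a 0 i) mid => //= *; lia.
apply: uniq_leq_size.
  rewrite !cat_uniq uE rem_uniq ?sumset_uniq //= andbT; apply/andP; split.
    rewrite has_sym; apply/hasPn => z /newE[zB zC] /=.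
    rewrite mem_cat negb_or zC andbT; apply: contra zB; exact: mem_rem.
  rewrite -all_predC; apply/allP => z /sumsetP[p [q [Hp Hq ->]]] /=.
  rewrite mem_rem_uniq ?sumset_uniq // !inE; apply/negP => /andP[/eqP ne].
  case/sumsetP => p' [q' [Hp' Hq' E']].
  have := a_mono i p; have := a_mono i q; have := a_mono p' i; have := a_mono q' i.
  lia.
move=> z; rewrite !mem_cat => /or3P[/subE//|/mem_rem|] /sumsetP[p [q [Hp Hq ->]]];
  apply/sumsetP; exists p, q; split=> //; lia.
Qed.

(** If d divides a_0, ..., a_i but not everything, take the first a_j that d does
    not divide.  The i sums a_j + a_q with q < i are not divisible by d, so they
    are not sums of the first part; and being less than a_j + a_i they could
    only be sums of terms between a_i and a_j, all divisible by d.  With these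
    i sums the weak bound 2i + 1 on the first part suffices. *)
Lemma sumset_dvd_prefix (a : nat -> nat) (i n d : nat) :
  {homo a : i j / i < j} -> i <= n -> 3 * (n - i) <= size (sumset a i n) ->
  (forall j, j <= i -> d %| a j) ->
  3 * n <= size (sumset a 0 n) \/ (forall j, j <= n -> d %| a j).
Proof.
move=> a_incr le_in sizeC dB.
have a_mono := leq_mono a_incr; have a_lt := leqW_mono a_mono.
have aI : injective a by apply: incn_inj.
case: (boolP (all (fun j => d %| a j) (iota 0 n.+1))) => [/allP dA|].
  by right=> j jn; apply: dA; rewrite mem_iota.
rewrite -has_predC => /hasP ex; left.
have {ex} : exists j, (j <= n) && ~~ (d %| a j).
  by case: ex => j; rewrite mem_iota => jn dj; exists j; apply/andP.
case/ex_minnP => j /andP[jn ndj] minj.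
have lt_ij : i < j by rewrite ltnNge; apply: contra ndj => /dB.
have dlt k : k < j -> d %| a k.
  move=> kj; apply/negPn/negP => ndk; suff : j <= k by lia.
  by apply: minj; rewrite ndk; lia.
pose E := [seq a j + a q | q <- iota 0 i].
have uE : uniq E.
  by rewrite map_inj_uniq ?iota_uniq // => p q /eqP; rewrite eqn_add2l => /eqP/aI.
have subE : {subset E <= sumset a 0 n}.
  move=> z /mapP[q]; rewrite mem_iota => qi ->.
  by apply/sumsetP; exists j, q; split=> //; lia.
have newE z : z \in E -> z \notin sumset a 0 i /\ z \notin sumset a i n.
  move=> /mapP[q]; rewrite mem_iota => qi ->.
  have ndjq : ~~ (d %| a j + a q) by rewrite dvdn_addl //; apply: dlt; lia.
  split; apply: contra ndjq => /sumsetP[p [p' [Hp Hp' Epp]]]; rewrite Epp.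
    by rewrite dvdn_add // dB //; lia.
  have := a_mono i p; have := a_mono i p'; have := a_mono j p; have := a_mono j p'.
  by have := a_lt q i => *; rewrite dvdn_add // dlt //; lia.
have := sumset_split a_incr le_in uE subE newE; have := sumset_ge2n i a_incr.
rewrite size_map size_iota; lia.
Qed.

(** Strong induction on n.  Cut the sequence at the last i < n such that
    a_i - 2i <= a_n - 2n (i = 0 qualifies).  By maximality the part after a_i is
    dense in the sense of [sumset_late_density], which gives 3 (n - i) sums, and
    the first part has 3i sums by induction, unless it has a common divisor,
    where [sumset_dvd_prefix] applies.  The parts share one sum, so a single
    mixed sum is still needed.  If all a_(i+1) + a_j with j < i are old, then
    everything up to a_i is congruent modulo e = a_(i+1) - a_i, hence divisible
    by e since a_0 = 0; maximality of i makes e >= 2, so this is again the case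
    of a common divisor. *)
Theorem sumset_freiman (a : nat -> nat) (n : nat) :
  {homo a : i j / i < j} -> a 0 = 0 -> (forall i, i <= n -> 2 * i <= a i) ->
  3 * n <= size (sumset a 0 n) \/
  exists2 d, 1 < d & forall j, j <= n -> d %| a j.
Proof.
move=> a_incr a0; have a_mono := leq_mono a_incr; have a_lt := leqW_mono a_mono.
elim/ltn_ind: n => n IH sparse.
case: (posnP n) => [->|n0]; first by left.
have exi : exists i, (i < n) && (a i + 2 * n <= a n + 2 * i).
  by exists 0; have := sparse n (leqnn n); rewrite a0; lia.
have ubi i : (i < n) && (a i + 2 * n <= a n + 2 * i) -> i <= n by lia.
have [i /andP[lt_in sparse_i] maxi] := ex_maxnP exi ubi.
have sizeC : 3 * (n - i) <= size (sumset a i n).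
  apply: sumset_late_density => // j Hj; rewrite ltnNge; apply/negP => Hs.
  suff : j <= i by lia.
  by apply: maxi; lia.
have dvd_case d : 1 < d -> (forall j, j <= i -> d %| a j) ->
    3 * n <= size (sumset a 0 n) \/ exists2 d, 1 < d & forall j, j <= n -> d %| a j.
  move=> d1 dB; have [|dA] := sumset_dvd_prefix a_incr (ltnW lt_in) sizeC dB.
    by left.
  by right; exists d.
case: (posnP i) => [i0|i0].
  by left; move: sizeC; rewrite i0 subn0.
have [j ji|sizeB|[d d1 dB]] := IH i lt_in; [by apply: sparse; lia| |exact: dvd_case dB].
have step : a i + 2 <= a i.+1.
  have [lt_i1n|] := ltnP i.+1 n.
    have : ~~ ((i.+1 < n) && (a i.+1 + 2 * n <= a n + 2 * i.+1)).
      by apply/negP => /maxi; rewrite ltnn.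
    lia.
  by move=> le_ni; have En : n = i.+1; [lia|rewrite -En; lia].
case: (boolP (all (fun j => a i.+1 + a j \in sumset a 0 i) (iota 0 i))) => [/allP all_old|].
  have eq_step : a i.+1 + a i.-1 = a i + a i.
    have /all_old/sumsetP[p [q [Hp Hq E]]] : i.-1 \in iota 0 i by rewrite mem_iota; lia.
    have := a_mono p i; have := a_mono q i; have := a_mono p i.-1; have := a_mono q i.-1.
    have := a_lt i.-1 i.
    by have [Epi|] := eqVneq p i; have [Eqi|] := eqVneq q i; subst; lia.
  pose e := a i - a i.-1.
  have lt_pred : a i.-1 < a i by rewrite a_lt; lia.
  (* A sum equal to a_(i+1) + a_(i-k) with indices at most i must have both
     indices above i - k, where the congruence is already known. *)
  have cong k : k <= i -> e %| a i - a (i - k).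
    elim/ltn_ind: k => k IHk ki.
    case: k IHk ki => [|[|k]] IHk ki; [by rewrite subn0 subnn dvdn0|by rewrite subn1 |].
    have /all_old/sumsetP[p [q [/andP[_ pi] /andP[_ qi] E]]] : i - k.+2 \in iota 0 i
      by rewrite mem_iota; lia.
    have late x y : y <= i -> a i.+1 + a (i - k.+2) = a x + a y -> i - k.+2 < x.
      move=> yi Exy; rewrite ltnNge; apply/negP => xk.
      have le_x : a x <= a (i - k.+2) by rewrite a_mono.
      have le_y : a y <= a i by rewrite a_mono.
      by clear -le_x le_y Exy step; lia.
    have cong_late x : i - k.+2 < x -> x <= i -> e %| a i - a x.
      move=> kx xi; rewrite -[in X in _ - X](subKn xi); apply: IHk; last exact: leq_subr.
      by clear -kx xi ki; lia.
    have dp : e %| a i - a p by apply: cong_late; first exact: late E.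
    have dq : e %| a i - a q.
      by apply: cong_late; first by apply: (late q p pi); rewrite E addnC.
    have le_p : a p <= a i by rewrite a_mono.
    have le_q : a q <= a i by rewrite a_mono.
    have le_k : a (i - k.+2) <= a i by rewrite a_mono leq_subr.
    have -> : a i - a (i - k.+2) = (a i - a p) + (a i - a q) + e.
      by rewrite /e; clear -le_p le_q le_k E eq_step step lt_pred; lia.
    by rewrite !dvdn_add.
  have de : e %| a i by have := cong i (leqnn i); rewrite subnn a0 subn0.
  apply: (dvd_case e); first by rewrite /e; lia.
  move=> j ji; have := cong (i - j) (leq_subr _ _); rewrite subKn // => dj.
  rewrite -(dvdn_addr _ dj) subnK //; by rewrite a_mono.
rewrite -has_predC => /hasP[q]; rewrite mem_iota /= => qi new; left.
have := @sumset_split a i n [:: a i.+1 + a q] a_incr (ltnW lt_in) isT.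
suff H : {subset [:: a i.+1 + a q] <= sumset a 0 n} /\
  (forall z, z \in [:: a i.+1 + a q] -> z \notin sumset a 0 i /\ z \notin sumset a i n).
  by case: H => H1 H2 /(_ H1 H2) /=; lia.
split=> z; rewrite inE => /eqP->.
  by apply/sumsetP; exists i.+1, q; split=> //; lia.
split=> //; apply/negP => /sumsetP[p [p' [Hp Hp' E]]].
case/negP: new; apply/sumsetP; exists i, i; split; rewrite ?leqnn //.
have le_i x y : i <= y -> a i.+1 + a q = a x + a y -> x <= i.
  move=> iy Exy; rewrite leqNgt; apply/negP => ix.
  have := a_mono i.+1 x; have := a_lt q i; have := a_mono i y; lia.
have Ep : p = i by have := le_i p p'; lia.
have Ep' : p' = i by have := le_i p' p; lia.
by rewrite E Ep Ep'.
Qed.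

(** * Counting in additively closed sets *)

Definition card_below (b : pred nat) (n : nat) : nat := count b (iota 0 n).

Lemma card_belowS (b : pred nat) (n : nat) :
  card_below b n.+1 = card_below b n + b n.
Proof. by rewrite /card_below -addn1 iotaD count_cat /= addn0. Qed.

Lemma card_belowC (b : pred nat) (n : nat) :
  card_below b n + card_below (predC b) n = n.
Proof. by rewrite count_predC size_iota. Qed.

Lemma card_below_const (b : pred nat) (c : bool) (m n : nat) :
  m <= n -> (forall x, m <= x -> b x = c) ->
  card_below b n = card_below b m + c * (n - m).
Proof.
move=> le_mn bc; rewrite -{1}(subnKC le_mn).
elim: (n - m) => [|k IH]; first by rewrite addn0 muln0 addn0.
by rewrite addnS card_belowS IH bc ?leq_addr // mulnS; lia.
Qed.

Lemma card_below_ge (b : pred nat) (s : seq nat) (n : nat) :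
  uniq s -> (forall x, x \in s -> x < n /\ b x) -> size s <= card_below b n.
Proof.
move=> us sP; rewrite /card_below -size_filter; apply: uniq_leq_size => // x /sP[xn bx].
by rewrite mem_filter bx mem_iota.
Qed.

(** By pigeonhole n is a sum of two elements below n, so n is in b; adding one
    element keeps b in the majority, and the argument repeats for n + 1. *)
Lemma dense_closed_cofinal (b : pred nat) (n : nat) :
  (forall x y, b x -> b y -> b (x + y)) ->
  n.+1 < 2 * card_below b n -> forall y, n <= y -> b y.
Proof.
move=> closed dense.
have next m : m.+1 < 2 * card_below b m -> b m.
  rewrite /card_below -size_filter => H.
  have [|||x [y [bx b_y <-]]] := @pigeonhole_sum (filter b (iota 0 m)) m.
  - by rewrite filter_uniq ?iota_uniq.
  - by move=> x; rewrite mem_filter mem_iota; lia.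
  - by [].
  by apply: closed; [move: bx|move: b_y]; rewrite mem_filter => /andP[].
have inv k : (n + k).+1 < 2 * card_below b (n + k).
  elim: k => [|k IH]; first by rewrite addn0.
  by rewrite addnS card_belowS next //; lia.
by move=> y /subnKC <-; apply: next.
Qed.

(** Finiteness and cardinality of the set of gaps in one statement about
    counting. *)
Definition has_genus (b : pred nat) (g : nat) :=
  exists M, forall n, M <= n -> card_below (predC b) n = g.

Lemma gaps_below (b : pred nat) (g n : nat) :
  has_genus b g -> card_below (predC b) n <= g.
Proof.
move=> [M /(_ (maxn M n) (leq_maxl _ _)) <-].
rewrite /card_below -(subnKC (leq_maxr M n)) iotaD count_cat; exact: leq_addr.
Qed.

Lemma gaps_below_cofinal (b : pred nat) (g m : nat) :
  has_genus b g -> (forall x, m <= x -> b x) -> card_below (predC b) m = g.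
Proof.
move=> [M /(_ (maxn M m) (leq_maxl _ _)) <-] bx.
by rewrite (@card_below_const _ false m (maxn M m)) ?mul0n ?addn0 ?leq_maxr // => x /bx /= ->.
Qed.

(** If x is a gap, at most one of y and x - y is in b for each y, so at least half
    of [0, x] consists of gaps. *)
Lemma gap_lt_double_genus (b : pred nat) (g : nat) :
  (forall x y, b x -> b y -> b (x + y)) -> has_genus b g ->
  forall x, 2 * g <= x -> b x.
Proof.
move=> closed gen x gx; apply/negPn/negP => nbx.
have H : ~ (x.+1 < 2 * card_below b x).
  by move=> /(dense_closed_cofinal closed) /(_ x (leqnn x)) bx; rewrite bx in nbx.
have := card_belowC b x; have := gaps_below x.+1 gen; rewrite card_belowS /= nbx; lia.
Qed.

(** Past the elements up to g, the default g + i continues the enumeration so that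
    it is strictly increasing on all of nat. *)
Definition enum_below (b : pred nat) (g i : nat) : nat :=
  nth (g + i) (filter b (iota 0 g.+1)) i.

Lemma enum_below_incr (b : pred nat) (g : nat) :
  0 < card_below b g.+1 ->
  {homo enum_below b g : i j / i < j}.
Proof.
rewrite /card_below -size_filter /enum_below; set s := filter b _ => s0 i j ij.
have srt : sorted ltn s by apply: sorted_filter; [exact: ltn_trans|exact: iota_ltn_sorted].
have [js|sj] := ltnP j (size s).
  rewrite (set_nth_default (g + j) (g + i)); last lia.
  by apply: (sorted_ltn_nth ltn_trans) => //; rewrite inE; lia.
rewrite [X in _ < X]nth_default //.
have [is_|si] := ltnP i (size s); last by rewrite nth_default // ltn_add2l.
have := mem_nth (g + i) is_; rewrite mem_filter mem_iota => /andP[_].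
by move: (nth _ _ _) => v; lia.
Qed.

Lemma enum_belowP (b : pred nat) (g i : nat) :
  i < card_below b g.+1 -> b (enum_below b g i) /\ enum_below b g i <= g.
Proof.
rewrite /card_below -size_filter /enum_below => /(mem_nth (g + i)).
by rewrite mem_filter mem_iota => /andP[].
Qed.

Lemma enum_below_onto (b : pred nat) (g x : nat) :
  b x -> x <= g -> exists2 i, i < card_below b g.+1 & enum_below b g i = x.
Proof.
move=> bx xg; have xs : x \in filter b (iota 0 g.+1) by rewrite mem_filter mem_iota bx; lia.
exists (index x (filter b (iota 0 g.+1))).
  by rewrite /card_below -size_filter index_mem.
by rewrite /enum_below nth_index.
Qed.

(** If a_i < 2i, the majority of [0, a_i] is in b, so every gap is below a_i; but
    a_i <= g and [0, a_i] contains at least i + 1 nongaps, which leaves fewer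
    than g gaps. *)
Lemma enum_below_sparse (b : pred nat) (g i : nat) :
  (forall x y, b x -> b y -> b (x + y)) -> has_genus b g ->
  i < card_below b g.+1 -> 2 * i <= enum_below b g i.
Proof.
move=> closed gen ir; rewrite leqNgt; apply/negP => lt_a.
have a_incr := @enum_below_incr b g (leq_ltn_trans (leq0n i) ir).
have a_mono := leq_mono a_incr; have aI : injective (enum_below b g) by apply: incn_inj.
set a := enum_below b g in lt_a a_incr a_mono aI *.
have ge_i : i.+1 <= card_below b (a i).+1.
  have -> : i.+1 = size [seq a j | j <- iota 0 i.+1] by rewrite size_map size_iota.
  apply: card_below_ge; first by rewrite map_inj_uniq ?iota_uniq.
  move=> x /mapP[j]; rewrite mem_iota => ji ->; split; last first.
    by apply: (enum_belowP _).1; lia.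
  by rewrite ltnS a_mono; lia.
have [_ ag] := enum_belowP ir; rewrite -/a in ag.
have := gaps_below_cofinal gen (@dense_closed_cofinal b (a i).+1 closed _).
have := card_belowC b (a i).+1 => E /(_ _); lia.
Qed.

(** The sumset of the r + 1 elements up to g is contained in the g + 1 elements up
    to 2g, too few for the first alternative of [sumset_freiman]. *)
Lemma small_elements_even (b : pred nat) (g r : nat) :
  b 0 -> (forall x y, b x -> b y -> b (x + y)) -> has_genus b g ->
  card_below b g.+1 = r.+1 -> g + 2 <= 3 * r ->
  forall x, x <= g -> b x -> ~~ odd x.
Proof.
move=> b0 closed gen Er large.
have a_incr : {homo enum_below b g : i j / i < j} by apply: enum_below_incr; rewrite Er.
have ainb i : i <= r -> b (enum_below b g i) /\ enum_below b g i <= g.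
  by move=> ir; apply: enum_belowP; rewrite Er.
have a0 : enum_below b g 0 = 0 by rewrite /enum_below /= b0.
have sparse i : i <= r -> 2 * i <= enum_below b g i.
  by move=> ir; apply: enum_below_sparse; rewrite ?Er.
have [sums|[d d1 dvd_a]] := sumset_freiman a_incr a0 sparse.
  have le_sums : size (sumset (enum_below b g) 0 r) <= card_below b (2 * g).+1.
    apply: card_below_ge; first exact: sumset_uniq.
    move=> x /sumsetP[i [j [/andP[_ /ainb[bi ig]] /andP[_ /ainb[bj jg]] ->]]].
    by split; [lia|exact: closed].
  have := gaps_below_cofinal gen (m := (2 * g).+1) _.
  have := card_belowC b (2 * g).+1 => E /(_ _) H.
  have : card_below (predC b) (2 * g).+1 = g.
    by apply: H => x gx; apply: (gap_lt_double_genus closed gen); lia.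
  lia.
have growth i : i <= r -> d * i <= enum_below b g i.
  elim: i => [|i IH] ir; first by rewrite muln0.
  have lt_a := a_incr i i.+1 (ltnSn i).
  have : d %| enum_below b g i.+1 - enum_below b g i by rewrite dvdn_sub ?dvd_a //; lia.
  move=> /dvdn_leq; rewrite subn_gt0 => /(_ lt_a); have := IH (ltnW ir); lia.
have d2 : d = 2.
  have := growth r (leqnn r); have := (ainb r (leqnn r)).2.
  have [d3 ? ?|? _ _] := leqP 3 d; last by lia.
  by have : 3 * r <= d * r; [rewrite leq_mul2r d3 orbT|lia].
move=> x xg bx; have [i ir <-] := enum_below_onto bx xg.
by have := dvd_a i; rewrite d2 dvdn2; apply; rewrite -ltnS -Er.
Qed.

Lemma card_below_even (b : pred nat) (n : nat) :
  (forall x, x <= n -> b x -> ~~ odd x) ->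
  card_below (fun k => b (2 * k)) (n./2).+1 = card_below b n.+1.
Proof.
move=> even_b; rewrite /card_below -!size_filter.
rewrite -(size_map (muln 2)); apply/perm_size/uniq_perm.
- by rewrite map_inj_uniq ?filter_uniq ?iota_uniq // => x y; lia.
- by rewrite filter_uniq ?iota_uniq.
move=> x; rewrite mem_filter mem_iota; apply/mapP/andP.
  by case=> k; rewrite mem_filter mem_iota => /andP[bk kn] ->; split=> //; lia.
move=> [bx xn]; have := even_b x _ bx => ox; exists x./2; last by lia.
have Ex : 2 * x./2 = x by lia.
by rewrite mem_filter mem_iota /= Ex bx; lia.
Qed.

Lemma card_below_double (p : pred nat) (n : nat) :
  card_below p (2 * n) =
  card_below (fun k => p (2 * k)) n + card_below (fun k => p (2 * k).+1) n.
Proof.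
elim: n => [|n IH]; first by rewrite muln0.
have -> : 2 * n.+1 = (2 * n).+2 by lia.
rewrite !card_belowS IH; lia.
Qed.

(** Odd gaps minus even gaps: an even gap is never a right end, and an odd gap x
    fails to be one exactly when x + 1 is one of the even gaps. *)
Lemma card_right_ends (b : pred nat) (g r : nat) :
  b 0 -> (forall x y, b x -> b y -> b (x + y)) -> has_genus b g ->
  card_below b g.+1 = r.+1 -> g + 2 <= 3 * r ->
  card_below (fun x => ~~ b x && b x.+1) (2 * g.+1) = odd g + 2 * r.
Proof.
move=> b0 closed gen Er large.
have even_b := small_elements_even b0 closed gen Er large.
pose b2 k := b (2 * k).
have closed2 x y : b2 x -> b2 y -> b2 (x + y) by rewrite /b2 mulnDr; apply: closed.
have cE : card_below b2 (g./2).+1 = r.+1 by rewrite card_below_even.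
have b2_large k : g./2 <= k -> b2 k.
  by apply: (dense_closed_cofinal closed2); move: cE; rewrite card_belowS; lia.
have gE := card_below_double (predC b) g.+1.
(* Among the odd gaps, those that are not right ends correspond to the even
   gaps 2k + 2; the even count is shifted by one because 0 is not a gap. *)
have tele n : card_below (fun k => ~~ b (2 * k).+1 && b (2 * k).+2) n
              + card_below (predC b2) n.+1 = card_below (fun k => predC b (2 * k).+1) n.
  elim: n => [|n IH]; first by rewrite card_belowS /= /b2 muln0 b0.
  rewrite [in RHS]card_belowS -IH [card_below (predC b2) _]card_belowS card_belowS /= /b2.
  have -> : 2 * n.+1 = (2 * n).+2 by lia.
  case: (boolP (b (2 * n).+2)) => [|nb]; first by lia.
  suff : ~~ b (2 * n).+1 by move=> ->; lia.
  apply/negP => bo; have := even_b (2 * n).+1 _ bo.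
  have : ~~ (g./2 <= n.+1).
    by apply: contra nb => /b2_large; rewrite /b2 mulnS.
  lia.
rewrite card_below_double.
(* An even gap is below g, so the odd number that follows it is a gap. *)
have -> : card_below (fun k => ~~ b (2 * k) && b (2 * k).+1) g.+1 = 0.
  rewrite /card_below; apply/eqP; rewrite -leqn0 leqNgt -has_count -all_predC.
  apply/allP => k _ /=; apply/negP => /andP[nb bo].
  have := even_b (2 * k).+1 _ bo.
  have : ~~ (g./2 <= k) by apply: contra nb => /b2_large.
  lia.
have tot : card_below (predC b) (2 * g.+1) = g.
  by apply: gaps_below_cofinal => // x gx; apply: (gap_lt_double_genus closed gen); lia.
have tail m : g./2 <= m -> card_below (predC b2) m = card_below (predC b2) g./2.
  by move=> gm; rewrite (@card_below_const _ false g./2) ?mul0n ?addn0 // => x /b2_large /= ->.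
have := card_belowC b2 (g./2).+1; rewrite cE tail; last lia.
have := tele g.+1; rewrite (tail g.+2); last lia.
move: gE; rewrite tot.
rewrite -[card_below (fun k => predC b (2 * k)) _]/(card_below (predC b2) _) tail; last lia.
lia.
Qed.

(** * The ordinarization number *)

Definition mem_pred_of (S : set nat) : pred nat := fun x => `[< S x >].

Lemma card_fset_below (A : set nat) (n : nat) :
  finite_set A -> (forall x, A x -> x < n) ->
  #|` fset_set A| = card_below (mem_pred_of A) n.
Proof.
move=> finA An; rewrite /card_below -size_filter.
apply/perm_size/uniq_perm; rewrite ?fset_uniq ?filter_uniq ?iota_uniq // => x.
rewrite in_fset_set // mem_filter mem_iota add0n /=.
apply/idP/andP => [/set_mem Ax|[/asboolP Ax _]]; last exact: mem_set.
by split; [exact/asboolP|exact: An].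
Qed.

Lemma le_frobenius (S : set nat) (x : nat) :
  finite_set (gaps S) -> ~ S x -> x <= frobenius S.
Proof.
move=> fin nSx; apply: (@leq_bigmax_seq _ _ xpredT) => //.
by rewrite in_fset_set //; apply: mem_set.
Qed.

Lemma bigmax_mem (s : seq nat) : 0 < \max_(x <- s) x -> \max_(x <- s) x \in s.
Proof.
elim: s => [|x s IH]; first by rewrite big_nil.
rewrite big_cons inE; set m := \max_(_ <- _) _ in IH *.
by case: (leqP m x) => [mx|xm]; [rewrite eqxx|rewrite IH ?orbT; lia].
Qed.

Lemma gap_frobenius (S : set nat) :
  finite_set (gaps S) -> 0 < frobenius S -> ~ S (frobenius S).
Proof.
move=> fin F0; suff : frobenius S \in fset_set (gaps S).
  by rewrite in_fset_set // => /set_mem.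
exact: bigmax_mem.
Qed.

Lemma genus_has_genus (S : set nat) :
  finite_set (gaps S) -> has_genus (mem_pred_of S) (genus S).
Proof.
move=> fin; exists (frobenius S).+1 => n le_n.
rewrite /genus (@card_fset_below _ n) //.
  by apply: eq_count => x /=; rewrite /mem_pred_of asbool_neg.
by move=> x /(le_frobenius fin); lia.
Qed.

(** 0 is always an element of S, so the bound says that [1, g] consists of gaps;
    these are then all the g gaps. *)
Lemma ordinary_card_below (S : set nat) :
  S 0 -> finite_set (gaps S) ->
  ordinary S <-> card_below (mem_pred_of S) (genus S).+1 <= 1.
Proof.
move=> S0 fin; have gen := genus_has_genus fin; set b := mem_pred_of S in gen *.
set g := genus S in gen *.
have b0 : b 0 by apply/asboolP.
have tot := card_belowC b g.+1.
split=> [ord|le1].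
  have : size (iota 1 g) <= card_below (predC b) g.+1.
    apply: card_below_ge; rewrite ?iota_uniq // => x; rewrite mem_iota => xg; split; first lia.
    by apply/asboolP; rewrite ord /= -/g => -[]; lia.
  by rewrite size_iota; lia.
apply/seteqP; split=> [x Sx|x [->//|gx]].
  case: (posnP x) => [->|x0]; [by left|right; rewrite -/g ltnNge; apply/negP => xg].
  have : size [:: 0; x] <= card_below b g.+1.
    apply: card_below_ge; first by rewrite /= inE; lia.
    by move=> y; rewrite !inE => /orP[] /eqP ->; split=> //; exact/asboolP.
  by rewrite /=; lia.
apply: contrapT => nSx.
have : size (x :: filter (predC b) (iota 0 g.+1)) <= card_below (predC b) x.+1.
  apply: card_below_ge.
    by rewrite cons_uniq filter_uniq ?iota_uniq // andbT mem_filter mem_iota; lia.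
  move=> y; rewrite inE mem_filter mem_iota => /orP[/eqP->|/andP[nby yg]].
    by split=> //; apply/asboolP.
  by split=> //; lia.
have := gaps_below x.+1 gen.
have -> y s : size (y :: s) = (size s).+1 by [].
rewrite size_filter -/(card_below _ _); lia.
Qed.

(** For a non-ordinary S, the multiplicity is at most g and the Frobenius number
    exceeds g, so the swap removes one element of [0, g] and keeps the number of
    gaps.  The first two conclusions let the step be iterated. *)
Lemma ordinarization_step (S : set nat) :
  S 0 -> finite_set (gaps S) -> ~ ordinary S ->
  [/\ ordinarization S 0, finite_set (gaps (ordinarization S)),
      genus (ordinarization S) = genus S &
      card_below (mem_pred_of S) (genus S).+1 =
      (card_below (mem_pred_of (ordinarization S)) (genus S).+1).+1].
Proof.
move=> S0 fin nord; have gen := genus_has_genus fin.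
have lt1 : 1 < card_below (mem_pred_of S) (genus S).+1.
  by rewrite ltnNge; apply/negP => /(ordinary_card_below S0 fin).
have -> : ordinarization S = (S `\ multiplicity S) `|` [set frobenius S].
  by rewrite /ordinarization; case: asboolP.
set b := mem_pred_of S in gen lt1 *; set g := genus S in gen lt1 *.
set m := multiplicity S; set F := frobenius S.
have [x Sx /andP[x0 xg]] : exists2 x, S x & 0 < x <= g.
  have : has b (iota 1 g).
    rewrite has_count; move: lt1; rewrite /card_below /=; case: (b 0); lia.
  by case/hasP => x; rewrite mem_iota => xg /asboolP Sx; exists x => //; lia.
have [[Sm m0] minm] : (S `\ 0) m /\ forall n, (S `\ 0) n -> m <= n.
  by apply: leastP; exists x; split=> // xe; move: x0; rewrite xe.
have mg : m <= g.
  by apply: leq_trans xg; apply: minm; split=> // xe; move: x0; rewrite xe.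
have gF : g < F.
  rewrite ltnNge; apply/negP => Fg.
  have /(gaps_below_cofinal gen) : forall y, g.+1 <= y -> b y.
    move=> y gy; apply/asboolP; apply: contrapT => nSy.
    by have := le_frobenius fin nSy; rewrite -/F; lia.
  have := card_belowC b g.+1; lia.
have nSF : ~ S F by apply: gap_frobenius => //; rewrite -/F; lia.
have m0' : m <> 0 by [].
have gapsE : gaps ((S `\ m) `|` [set F]) = [set m] `|` (gaps S `\ F).
  apply/seteqP; split=> y /=; rewrite /gaps /=.
    move=> /not_orP[nSy yF]; have [->|ym] := pselect (y = m); first by left.
    by right; split=> // Sy; apply: nSy; split.
  case=> [->|[nSy yF]] [[Sy ym]|].
  - exact: ym.
  - by move=> mF; move: gF; rewrite -mF; lia.
  - exact: nSy.
  - exact: yF.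
have fin' : finite_set (gaps S `\ F) by apply: finite_setD.
split.
- by left; split=> // m00; apply: m0'.
- by rewrite gapsE finite_setU; split=> //; apply: finite_set1.
- rewrite /g /genus gapsE fset_setU1 // fset_setD1 //.
  rewrite cardfsU1 in_fsetD1 in_fset_set // [in RHS](cardfsD1 F) in_fset_set //.
  rewrite (mem_set nSF : F \in gaps S) andbC; case: (m \in gaps S) / idP => // /set_mem.
  by move=> /(_ Sm).
have count n : n <= F -> card_below b n =
    card_below (mem_pred_of ((S `\ m) `|` [set F])) n + (m < n).
  elim: n => [|n IH] nF //; rewrite !card_belowS (IH (ltnW nF)).
  have -> : mem_pred_of ((S `\ m) `|` [set F]) n = b n && (n != m).
    apply/asboolP/andP => [[[Sn /eqP nm]|nE]|[/asboolP Sn /eqP nm]].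
    + by split=> //; apply/asboolP.
    + by move: nF; rewrite nE ltnn.
    + by left.
  have bm : b m by apply/asboolP.
  have [->|nm] := eqVneq n m; first by rewrite bm ltnn ltnSn andbF.
  by rewrite andbT; lia.
by rewrite count // ltnS mg addn1.
Qed.

Lemma ordinary_iter (S : set nat) (i : nat) :
  S 0 -> finite_set (gaps S) ->
  ordinary (iter i ordinarization S) <->
  card_below (mem_pred_of S) (genus S).+1 <= i.+1.
Proof.
elim: i S => [|i IH] S S0 fin; first exact: ordinary_card_below.
rewrite iterSr; have [ord|nord] := pselect (ordinary S).
  have -> : ordinarization S = S by rewrite /ordinarization; case: asboolP.
  have le1 := (ordinary_card_below S0 fin).1 ord.
  by rewrite IH //; split=> _; lia.
have [S0' fin' gE cE] := ordinarization_step S0 fin nord.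
by rewrite IH // gE cE.
Qed.

(** Each transform removes one element of [1, g] until none is left; the successor
    on the right accounts for 0, which always stays. *)
Lemma ordinarization_numberE (S : set nat) :
  S 0 -> finite_set (gaps S) ->
  card_below (mem_pred_of S) (genus S).+1 = (ordinarization_number S).+1.
Proof.
move=> S0 fin; set c := card_below _ _.
have c0 : 0 < c.
  apply: (@card_below_ge _ [:: 0]) => // x; rewrite inE => /eqP ->.
  by split=> //; apply/asboolP.
have ordc i : ordinary (iter i ordinarization S) <-> c <= i.+1 by apply: ordinary_iter.
have [|ord minr] := @leastP [set i | ordinary (iter i ordinarization S)].
  by exists c.-1; apply/ordc; rewrite prednK.
have := minr c.-1 ((ordc c.-1).2 _); move: ord => /ordc.
rewrite -/(ordinarization_number S) prednK // => ? /(_ (leqnn _)); lia.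
Qed.

(** * Intervals of gaps *)

(** A condition on y, rather than an explicit segment, so that no left end has to
    be chosen. *)
Definition gap_run (S : set nat) (x : nat) : set nat :=
  [set y | y <= x /\ forall z, y <= z <= x -> ~ S z].

Definition right_ends (S : set nat) : set nat := [set x | ~ S x /\ S x.+1].

Lemma gap_run_self (S : set nat) (x : nat) : ~ S x -> gap_run S x x.
Proof. by move=> nSx; split=> // z; rewrite -eqn_leq => /eqP <-. Qed.

Lemma consecutive_gap_run (S : set nat) (x : nat) :
  ~ S x -> consecutive (gap_run S x).
Proof.
move=> nSx.
have ex : exists y, `[< gap_run S x y >] by exists x; apply/asboolP/gap_run_self.
have [a /asboolP[ax gap_a] mina] := ex_minnP ex.
exists a, x; split=> //; apply/seteqP; split=> y /=.
  by move=> yx; rewrite (mina y) ?yx.1 //; apply/asboolP.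
move=> /andP[ay yx]; split=> // z /andP[yz zx]; apply: gap_a.
by rewrite (leq_trans ay yz).
Qed.

Lemma gap_intervalsE (S : set nat) :
  [set I | gap_interval S I] = gap_run S @` right_ends S.
Proof.
apply/seteqP; split=> [I [[a [b [ab IE]]] Igap Imax]|_ [x [nSx Sx1] <-]].
  have nSb : ~ S b by apply: Igap; rewrite IE /= ab leqnn.
  have sub_run : I `<=` gap_run S b.
    rewrite IE => y /= /andP[ay yb]; split=> // z /andP[yz zb].
    by apply: Igap; rewrite IE /= (leq_trans ay yz).
  exists b; last first.
    apply: Imax => //; first exact: consecutive_gap_run.
    by move=> y [yb gap_y]; apply: gap_y; rewrite leqnn.
  split=> //; apply: contrapT => nSb1.
  have : [set n | a <= n <= b.+1] b.+1 by rewrite /= leqnn andbT (leq_trans ab).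
  rewrite (Imax [set n | a <= n <= b.+1]).
  - by rewrite IE /= ltnn andbF.
  - by exists a, b.+1; rewrite (leq_trans ab).
  - move=> y /= /andP[ay]; rewrite leq_eqVlt => /orP[/eqP->//|yb].
    by apply: Igap; rewrite IE /= ay.
  - by rewrite IE => y /= /andP[-> /leqW].
split; first exact: consecutive_gap_run.
  by move=> y [yx gap_y]; apply: gap_y; rewrite leqnn.
move=> J [c [d [cd ->]]] Jgap sub_J; apply/seteqP; split=> // y /= /andP[cy yd].
have /= /andP[cx xd] := sub_J x (gap_run_self nSx).
have dx : d <= x.
  rewrite leqNgt; apply/negP => xd'; apply: (Jgap x.+1) => //=.
  by rewrite xd' (leq_trans cx).
split=> [|z /andP[yz zx]]; first exact: leq_trans dx.
by apply: Jgap => /=; rewrite (leq_trans cy yz) (leq_trans zx).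
Qed.

(** An interval of gaps is determined by its largest element, so counting
    intervals amounts to counting right ends. *)
Lemma num_gap_intervalsE (S : set nat) (n : nat) :
  finite_set (gaps S) -> (forall x, ~ S x -> x < n) ->
  num_gap_intervals S =
  card_below (fun x => ~~ mem_pred_of S x && mem_pred_of S x.+1) n.
Proof.
move=> fin gaps_n.
have finE : finite_set (right_ends S) by apply: sub_finite_set fin => x [].
rewrite /num_gap_intervals gap_intervalsE fset_set_image // card_in_imfset /=; last first.
  move=> x y; rewrite !in_fset_set // => /set_mem[nSx _] /set_mem[nSy _] E.
  have := gap_run_self nSx; rewrite E => -[xy _].
  have := gap_run_self nSy; rewrite -E => -[yx _].
  by apply/eqP; rewrite eqn_leq xy.
rewrite (@card_fset_below _ n) // => [|x [nSx _]]; last exact: gaps_n.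
by apply: eq_count => x; rewrite /mem_pred_of /right_ends /= asbool_and asbool_neg.
Qed.

Theorem lemma15 (S : set nat) (g r : nat) :
  numerical_semigroup S ->
  genus S = g ->
  ordinarization_number S = r ->
  ((g%:R + 2%:R) / 3%:R <= r%:R :> rat)%R ->
  (~~ odd g -> num_gap_intervals S = 2 * r) /\
  (odd g -> num_gap_intervals S = 2 * r + 1).
Proof.
move=> [S0 addS fin] gE rE.
rewrite Num.Theory.ler_pdivrMr // -GRing.natrD -GRing.natrM Num.Theory.ler_nat mulnC => large.
have gen := genus_has_genus fin; rewrite gE in gen.
have cr := ordinarization_numberE S0 fin; rewrite gE rE in cr.
have b0 : mem_pred_of S 0 by apply/asboolP.
have closed x y : mem_pred_of S x -> mem_pred_of S y -> mem_pred_of S (x + y).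
  by move=> /asboolP Sx /asboolP Sy; apply/asboolP/addS.
have gaps_small x : ~ S x -> x < 2 * g.+1.
  move=> nSx; rewrite ltnNge; apply/negP => gx; apply/nSx/asboolP.
  by apply: (gap_lt_double_genus closed gen); lia.
rewrite (num_gap_intervalsE fin gaps_small) (card_right_ends b0 closed gen cr large).
by case: (odd g); split=> // _; lia.
Qed.
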